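(* Let $\mathcal{H}_d$ be a complex Hilbert space of finite dimension $d$ with $2\leq d<\infty$. For any two observables $\mathsf{M}_1$ and $\mathsf{M}_2$ on $\mathcal{H}_d$ we have $$\frac{1}{2} < \frac{2+d}{2(1+d)} \leq \mathrm{jmd}(\mathsf{M}_1,\mathsf{M}_2).$$ In particular, there are no maximally incompatible pairs of observables on a finite dimensional Hilbert space.
   Context: An observable on a Hilbert space $\mathcal{H}$ with outcome space $\Omega$ (a Borel subset of some $\mathbb{R}^n$, with its Borel $\sigma$-algebra) is a normalized positive operator valued measure (POVM) $\mathsf{M}$ on $\Omega$, i.e. $\mathsf{M}(X)\geq 0$ are bounded operators, $\mathsf{M}$ is $\sigma$-additive in the weak operator topology and $\mathsf{M}(\Omega)=I$. An observable $\mathsf{T}$ is trivial if $\mathsf{T}(X)=\mu(X)I$ for some probability measure $\mu$ on $\Omega$. Two observables $\mathsf{M}_1,\mathsf{M}_2$ with outcome spaces $\Omega_1,\Omega_2$ are jointly measurable if there is an observable $\mathsf{M}$ on $\Omega_1\times\Omega_2$ with $\mathsf{M}(X\times\Omega_2)=\mathsf{M}_1(X)$ and $\mathsf{M}(\Omega_1\times Y)=\mathsf{M}_2(Y)$ for all Borel $X\subseteq\Omega_1$, $Y\subseteq\Omega_2$. The joint measurability region $J(\mathsf{M}_1,\mathsf{M}_2)$ is the set of $(\lambda,\mu)\in[0,1]\times[0,1]$ for which there exist trivial observables $\mathsf{T}_1$ on $\Omega_1$ and $\mathsf{T}_2$ on $\Omega_2$ such that $\lambda\mathsf{M}_1+(1-\lambda)\mathsf{T}_1$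 and $\mu\mathsf{M}_2+(1-\mu)\mathsf{T}_2$ are jointly measurable. The joint measurability degree $\mathrm{jmd}(\mathsf{M}_1,\mathsf{M}_2)$ is the greatest number $0\leq\lambda\leq 1$ such that $(\lambda,\lambda)\in J(\mathsf{M}_1,\mathsf{M}_2)$. The pair $\mathsf{M}_1,\mathsf{M}_2$ is maximally incompatible if $J(\mathsf{M}_1,\mathsf{M}_2)=\{(\lambda,\mu)\in[0,1]^2 : \lambda+\mu\leq 1\}$ (equivalently, $\mathrm{jmd}(\mathsf{M}_1,\mathsf{M}_2)=1/2$). *)

(* Defs.v *)
From HB Require Import structures.
From mathcomp Require Import all_boot all_order all_algebra.
From mathcomp Require Import all_classical all_reals all_analysis.
From mathcomp Require Import complex.
Set Implicit Arguments. Unset Strict Implicit. Unset Printing Implicit Defensive.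
Import Order.TTheory GRing.Theory Num.Theory.
Import numFieldNormedType.Exports.
Local Open Scope classical_set_scope.
Local Open Scope ring_scope.

(* The Hilbert space H_d is C^d = 'cV[R[i]]_d with the standard inner product;
   bounded operators are d x d complex matrices. *)

Definition inner (R : realType) (d : nat) (u : 'cV[R[i]]_d) (A : 'M[R[i]]_d)
  (v : 'cV[R[i]]_d) : R[i] :=
  ((map_mx (@conjc R) u)^T *m A *m v) ord0 ord0.

(* positive operator: <v, A v> >= 0 (real and nonnegative) for all v *)
Definition psd (R : realType) (d : nat) (A : 'M[R[i]]_d) : Prop :=
  forall v : 'cV[R[i]]_d, 0 <= inner v A v.

(* sigma-additivity in the weak operator topology, on the measurable subsets
   of the outcome space Om: for every disjoint sequence (F k) of measurable
   subsets of Om and all vectors u v, sum_k <u, M(F k) v> converges to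
   <u, M(U_k F k) v> (convergence in C, i.e. of real and imaginary parts). *)
Definition weak_sigma_additive (R : realType) (d : nat) (dT : measure_display)
  (T : measurableType dT) (Om : set T) (M : set T -> 'M[R[i]]_d) : Prop :=
  forall F : nat -> set T,
    (forall k, measurable (F k) /\ F k `<=` Om) -> trivIset setT F ->
    forall u v : 'cV[R[i]]_d,
      ((fun n => \sum_(k < n) Re (inner u (M (F k)) v)) @ \oo -->
          Re (inner u (M (\bigcup_k F k)) v)) /\
      ((fun n => \sum_(k < n) Im (inner u (M (F k)) v)) @ \oo -->
          Im (inner u (M (\bigcup_k F k)) v)).

(* A normalized POVM with outcome space Om (a measurable subset of T, with the
   trace sigma-algebra); M is only meaningful on measurable subsets of Om. *)
Definition observable (R : realType) (d : nat) (dT : measure_display)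
  (T : measurableType dT) (Om : set T) (M : set T -> 'M[R[i]]_d) : Prop :=
  [/\ measurable Om,
      (forall X, measurable X -> X `<=` Om -> psd (M X)),
      weak_sigma_additive Om M &
      M Om = 1%:M].

(* trivial observable: T(X) = mu(X) I with mu a probability measure on Om
   (represented as a probability on T concentrated on Om). *)
Definition trivial_observable (R : realType) (d : nat) (dT : measure_display)
  (T : measurableType dT) (Om : set T) (Tr : set T -> 'M[R[i]]_d) : Prop :=
  observable Om Tr /\
  exists mu : probability T R, mu Om = 1%E /\
    forall X, measurable X -> X `<=` Om ->
      Tr X = (real_complex R (fine (mu X))) *: 1%:M.

Definition mix (R : realType) (d : nat) (T : Type) (lam : R)
  (M Tr : set T -> 'M[R[i]]_d) : set T -> 'M[R[i]]_d :=
  fun X => real_complex R lam *: M X + real_complex R (1 - lam) *: Tr X.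

Definition jointly_measurable (R : realType) (d : nat)
  (d1 d2 : measure_display) (T1 : measurableType d1) (T2 : measurableType d2)
  (Om1 : set T1) (Om2 : set T2)
  (M1 : set T1 -> 'M[R[i]]_d) (M2 : set T2 -> 'M[R[i]]_d) : Prop :=
  exists M : set (T1 * T2) -> 'M[R[i]]_d,
    observable (Om1 `*` Om2) M /\
    (forall X, measurable X -> X `<=` Om1 -> M (X `*` Om2) = M1 X) /\
    (forall Y, measurable Y -> Y `<=` Om2 -> M (Om1 `*` Y) = M2 Y).

Definition jm_region (R : realType) (d : nat)
  (d1 d2 : measure_display) (T1 : measurableType d1) (T2 : measurableType d2)
  (Om1 : set T1) (Om2 : set T2)
  (M1 : set T1 -> 'M[R[i]]_d) (M2 : set T2 -> 'M[R[i]]_d) : set (R * R) :=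
  [set p | [/\ 0 <= p.1 <= 1, 0 <= p.2 <= 1 &
     exists (Tr1 : set T1 -> 'M[R[i]]_d) (Tr2 : set T2 -> 'M[R[i]]_d),
       [/\ trivial_observable Om1 Tr1, trivial_observable Om2 Tr2 &
           jointly_measurable Om1 Om2 (mix p.1 M1 Tr1) (mix p.2 M2 Tr2)]]].

Definition jmd (R : realType) (d : nat)
  (d1 d2 : measure_display) (T1 : measurableType d1) (T2 : measurableType d2)
  (Om1 : set T1) (Om2 : set T2)
  (M1 : set T1 -> 'M[R[i]]_d) (M2 : set T2 -> 'M[R[i]]_d) : R :=
  sup [set lam : R | 0 <= lam <= 1 /\ jm_region Om1 Om2 M1 M2 (lam, lam)].

Definition maximally_incompatible (R : realType) (d : nat)
  (d1 d2 : measure_display) (T1 : measurableType d1) (T2 : measurableType d2)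
  (Om1 : set T1) (Om2 : set T2)
  (M1 : set T1 -> 'M[R[i]]_d) (M2 : set T2 -> 'M[R[i]]_d) : Prop :=
  jm_region Om1 Om2 M1 M2 =
  [set p : R * R | [/\ 0 <= p.1 <= 1, 0 <= p.2 <= 1 & p.1 + p.2 <= 1]].

(* Main.v *)
Require Import Defs.
From HB Require Import structures.
From mathcomp Require Import all_boot all_order all_algebra.
From mathcomp Require Import all_classical all_reals all_analysis.
From mathcomp Require Import complex ring lra.
Import Order.TTheory GRing.Theory Num.Theory.
Import numFieldNormedType.Exports.
Local Open Scope classical_set_scope.
Local Open Scope ring_scope.

(** The symmetric optimal cloning channel of dimension [d] sends a product
    effect [A (x) B] to [(tr B A + tr A B + A B + B A) / (2 (d + 1))], which is
    positive for positive [A], [B] because [|A v|^2 <= tr A <v, A v>].  Putting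
    [B = 1] gives [l A + (1 - l) (tr A / d) 1] with [l = (2 + d) / (2 (1 + d))],
    so applying this map to [M1 (x) M2] yields a joint observable of the two
    observables mixed with weight [l] with their traces.

    To pass from rectangles to the product sigma-algebra, polarization writes
    [M1] and [M2] as combinations of fixed matrices weighted by finite positive
    measures, and the joint observable is the corresponding combination of
    product measures.  Positivity on rectangles extends to all measurable sets
    since these are approximated, for any finite measure, by finite disjoint
    unions of rectangles. *)

Local Notation Re := complex.Re.
Local Notation Im := complex.Im.

(** * Positive matrices and positivity of the cloned product *)

Section inner_form.
Context {R : realType} {d : nat}.
Local Notation C := R[i].
Implicit Types (u v w : 'cV[C]_d) (A B : 'M[C]_d).

Lemma innerE u A v :
  inner u A v = \sum_i \sum_j conjc (u i ord0) * A i j * v j ord0.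
Proof.
rewrite /inner -mulmxA mxE; apply: eq_bigr => i _.
rewrite !mxE mulr_sumr; apply: eq_bigr => j _; by rewrite mulrA.
Qed.

Lemma innerDl u w A v : inner (u + w) A v = inner u A v + inner w A v.
Proof. by rewrite /inner map_mxD linearD /= !mulmxDl mxE. Qed.

Lemma innerDr u A v w : inner u A (v + w) = inner u A v + inner u A w.
Proof. by rewrite /inner mulmxDr mxE. Qed.

Lemma innerZl a u A v : inner (a *: u) A v = conjc a * inner u A v.
Proof. by rewrite /inner map_mxZ linearZ /= -!scalemxAl mxE. Qed.

Lemma innerZr a u A v : inner u A (a *: v) = a * inner u A v.
Proof. by rewrite /inner -!scalemxAr mxE. Qed.

Lemma inner_add u A B v : inner u (A + B) v = inner u A v + inner u B v.
Proof. by rewrite /inner mulmxDr mulmxDl mxE. Qed.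

Lemma inner_scale a u A v : inner u (a *: A) v = a * inner u A v.
Proof. by rewrite /inner -scalemxAr -scalemxAl mxE. Qed.

Lemma inner0 u v : inner u 0 v = 0.
Proof. by rewrite /inner mulmx0 mul0mx mxE. Qed.

Lemma inner_sum (I : finType) u (F : I -> 'M[C]_d) v :
  inner u (\sum_i F i) v = \sum_i inner u (F i) v.
Proof.
apply: (big_morph (fun A => inner u A v)); first by move=> ? ?; exact: inner_add.
exact: inner0.
Qed.

Lemma inner_delta A i j : inner (delta_mx i ord0) A (delta_mx j ord0) = A i j.
Proof.
rewrite innerE (bigD1 i) //= [X in _ + X]big1 ?addr0 => [|k ki]; last first.
  by apply: big1 => l _; rewrite mxE (negbTE ki) andFb conjc0 !mul0r.
rewrite (bigD1 j) //= big1 ?addr0 => [|k kj].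
  by rewrite !mxE !eqxx conjc1 mul1r mulr1.
by rewrite [X in _ * X]mxE (negbTE kj) andFb mulr0.
Qed.

Lemma inner_delta_l A i v : inner (delta_mx i ord0) A v = (A *m v) i ord0.
Proof.
rewrite innerE (bigD1 i) //= [X in _ + X]big1 ?addr0 => [|k ki]; last first.
  by apply: big1 => l _; rewrite mxE (negbTE ki) andFb conjc0 !mul0r.
by rewrite [RHS]mxE; apply: eq_bigr => j _; rewrite mxE !eqxx conjc1 mul1r.
Qed.

(** The form is real on the diagonal. Its values at [u + v] and [u + i v] therefore have no
    imaginary part, which links the two cross terms. *)
Lemma psd_herm A u v : psd A -> inner u A v = conjc (inner v A u).
Proof.
move=> pA; have := pA u; have := pA v.
have := pA (u + 'i%C *: v); have := pA (u + v).
rewrite !(innerDl, innerDr, innerZl, innerZr) !lecE.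
case: (inner u A v) (inner v A u) (inner u A u) (inner v A v) => [a b] [a' b'] [c c'] [e e'] /=.
move=> /andP[/eqP h1 _] /andP[/eqP h2 _] /andP[/eqP h3 _] /andP[/eqP h4 _].
apply/eqP; rewrite eq_complex /=.
by apply/andP; split; apply/eqP; lra.
Qed.

Lemma psd_ge0 A v : psd A -> 0 <= Re (inner v A v).
Proof. by move=> pA; have := pA v; rewrite lecE => /andP[]. Qed.

Lemma psd_real A v : psd A -> inner v A v = (Re (inner v A v))%:C%C.
Proof.
move=> pA; have := pA v; rewrite lecE; case: (inner v A v) => a b /= /andP[/eqP -> _] //.
Qed.

(** Positivity at [v - t <u, A v> u] for real [t] gives a quadratic inequality in [t]; a suitable
    [t] yields the bound, also when [<u, A u>] vanishes. *)
Lemma psd_cauchy_schwarz A u v : psd A ->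
  inner u A v * conjc (inner u A v) <= inner u A u * inner v A v.
Proof.
move=> pA; have hz := psd_herm A v u pA.
have key (t : R) : 0 <= inner v A v
    - (2 * t)%:C%C * (inner u A v * conjc (inner u A v))
    + (t ^+ 2)%:C%C * (inner u A v * conjc (inner u A v)) * inner u A u.
  have e z : conjc (- (t%:C%C * z)) = - (t%:C%C * conjc z) :> C.
    by rewrite rmorphN rmorphM /= oppr0.
  have := pA (v + (- (t%:C%C * inner u A v)) *: u).
  rewrite !(innerDl, innerDr, innerZl, innerZr) hz e.
  have -> : (2 * t)%:C%C = 2 * t%:C%C :> C by rewrite rmorphM rmorph_nat.
  have -> : (t ^+ 2)%:C%C = t%:C%C ^+ 2 :> C by rewrite rmorphXn.
  by congr (_ <= _); ring.
rewrite (psd_real A u pA) (psd_real A v pA) in key *.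
move: (psd_ge0 A u pA) (psd_ge0 A v pA) key.
move: (Re (inner u A u)) (Re (inner v A v)) (inner u A v) => p a [x y] p0 a0 key.
suff: x ^+ 2 + y ^+ 2 <= p * a.
  by move=> h; rewrite lecE /=; apply/andP; split; [apply/eqP; ring|lra].
have {}key t : 0 <= a - 2 * t * (x ^+ 2 + y ^+ 2) + t ^+ 2 * (x ^+ 2 + y ^+ 2) * p.
  by have := key t; rewrite lecE /= => /andP[_]; congr (_ <= _); ring.
move: (x ^+ 2 + y ^+ 2) key (addr_ge0 (sqr_ge0 x) (sqr_ge0 y)) => q key q0.
have [pz|pn] := eqVneq p 0; last first.
  have pp : 0 < p by rewrite lt_neqAle eq_sym pn.
  (* This [t] minimizes the quadratic when [q] is nonzero. *)
  have := key p^-1.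
  rewrite (_ : _ + _ = a - p^-1 * q); last by field.
  by rewrite subr_ge0 mulrC ler_pdivrMr// mulrC.
have [->|qn] := eqVneq q 0; first by rewrite mulr_ge0.
(* With [p = 0] the expression is affine in [t], and this [t] makes it equal to [-1]. *)
have := key ((a + 1) / (2 * q)); rewrite pz mulr0 addr0.
rewrite (_ : _ - _ = -1); last by field.
by lra.
Qed.

(* Sum the Cauchy-Schwarz inequality for [A] over the standard basis. *)
Lemma psd_sqnorm_le_trace A v : psd A ->
  \sum_i (A *m v) i ord0 * conjc ((A *m v) i ord0) <= \tr A * inner v A v.
Proof.
move=> pA; rewrite /mxtrace mulr_suml; apply: ler_sum => i _.
by rewrite -inner_delta_l -inner_delta; exact: psd_cauchy_schwarz.
Qed.

(** A positive matrix is self-adjoint, so the left factor moves to the other side of the inner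
    product. *)
Lemma psd_mulmx A B v : psd A ->
  inner v (A *m B) v = \sum_i conjc ((A *m v) i ord0) * (B *m v) i ord0.
Proof.
move=> pA; rewrite /inner mulmxA -mulmxA mxE; apply: eq_bigr => i _; congr (_ * _).
rewrite !mxE rmorph_sum; apply: eq_bigr => j _ /=.
by rewrite rmorphM /= -(inner_delta A i j) -psd_herm// inner_delta !mxE mulrC.
Qed.

Lemma psd_trace_ge0 A : psd A -> 0 <= \tr A.
Proof. by move=> pA; apply: sumr_ge0 => i _; rewrite -inner_delta. Qed.

(** Put [x = A v], [y = B v], [s = tr A], [t = tr B]. The trace bound on [|x|^2] and [|y|^2] shows
    that [s t] times the value of the form at [v] is at least [|t x + s y|^2]. *)
Lemma psd_clone A B : psd A -> psd B ->
  psd (\tr B *: A + \tr A *: B + A *m B + B *m A).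
Proof.
move=> pA pB v; rewrite !inner_add !inner_scale (psd_mulmx A B v pA) (psd_mulmx B A v pB).
have hA := psd_sqnorm_le_trace A v pA; have hB := psd_sqnorm_le_trace B v pB.
have a0 := pA v; have b0 := pB v; have s0 := psd_trace_ge0 A pA; have t0 := psd_trace_ge0 B pB.
move: hA hB a0 b0 s0 t0; set x := A *m v; set y := B *m v.
move: (inner v A v) (inner v B v) (\tr A) (\tr B) => a b s t hA hB a0 b0 s0 t0.
have sq0 (z : 'cV[C]_d) : 0 <= \sum_i z i ord0 * conjc (z i ord0).
  by apply: sumr_ge0 => i _; exact: mulcJ_ge0.
have z0 (z : 'cV[C]_d) : \sum_i z i ord0 * conjc (z i ord0) <= 0 -> forall i, z i ord0 = 0.
  move=> h i; have /eqP := le_anti (introT andP (conj h (sq0 z))).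
  rewrite psumr_eq0 => [|j _]; last exact: mulcJ_ge0.
  move=> /allP /(_ i (mem_index_enum _)) /=.
  by rewrite mulf_eq0 conjc_eq0 orbb => /eqP.
(* If a trace vanishes, the trace bound forces the corresponding vector to be zero, and the cross
   terms disappear. *)
have [s00|sn] := eqVneq s 0.
  rewrite {}s00 mul0r in hA *.
  rewrite !big1 => [|i _|i _]; rewrite ?(z0 x hA) ?conjc0 ?mulr0 ?mul0r//.
  by rewrite !addr0 mulr_ge0.
have [t00|tn] := eqVneq t 0.
  rewrite {}t00 mul0r in hB *.
  rewrite !big1 => [|i _|i _]; rewrite ?(z0 y hB) ?conjc0 ?mulr0 ?mul0r//.
  by rewrite !addr0 add0r mulr_ge0.
have st0 : 0 < s * t by rewrite mulr_gt0// lt_neqAle eq_sym ?sn ?tn.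
rewrite -(pmulr_rge0 _ st0).
have cs : conjc s = s by case: (s) s0 => ? ?; rewrite lecE /= => /andP[/eqP-> _]; rewrite oppr0.
have ct : conjc t = t by case: (t) t0 => ? ?; rewrite lecE /= => /andP[/eqP-> _]; rewrite oppr0.
(* expand [|t x + s y|^2 >= 0] *)
have := sq0 (t *: x + s *: y); have e i : (t *: x + s *: y) i ord0 *
    conjc ((t *: x + s *: y) i ord0) = t ^+ 2 * (x i ord0 * conjc (x i ord0)) +
    s ^+ 2 * (y i ord0 * conjc (y i ord0)) + s * t * (conjc (x i ord0) * y i ord0)
     + s * t * (conjc (y i ord0) * x i ord0).
  have -> : (t *: x + s *: y) i ord0 = t * x i ord0 + s * y i ord0 by rewrite !mxE.
  by rewrite rmorphD !rmorphM /= cs ct; ring.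
rewrite (eq_bigr _ (fun i _ => e i)).
rewrite !big_split /= -!mulr_sumr => h.
apply: le_trans h _; rewrite !mulrDr !lerD2r; apply: lerD.
  rewrite [leRHS](_ : _ = t ^+ 2 * (s * a)); last by ring.
  by rewrite ler_wpM2l// exprn_ge0.
rewrite [leRHS](_ : _ = s ^+ 2 * (t * b)); last by ring.
by rewrite ler_wpM2l// exprn_ge0.
Qed.

End inner_form.

(** * Polarization and the cloning map *)

Section polarization.
Context {R : realType} {d : nat}.
Local Notation C := R[i].
Implicit Types (u v : 'cV[C]_d) (A B : 'M[C]_d).

(** Summing over the fourth roots of unity against their conjugates cancels every term of the
    expanded form except [<u, A v>]. *)
Lemma inner_polarization u A v :
  inner u A v = \sum_(k < 4) 4^-1 * conjc ('i%C ^+ k) *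
    inner (u + 'i%C ^+ k *: v) A (u + 'i%C ^+ k *: v).
Proof.
have sum4 (F : nat -> C) : \sum_(k < 4) F k = F 0%N + F 1%N + F 2%N + F 3%N.
  by rewrite !big_ord_recr big_ord0 /= add0r.
rewrite (sum4 (fun k => 4^-1 * conjc ('i%C ^+ k) *
  inner (u + 'i%C ^+ k *: v) A (u + 'i%C ^+ k *: v))).
have i2 : 'i%C ^+ 2 = -1 :> C by exact: sqr_i.
have i3 : 'i%C ^+ 3 = - 'i%C :> C by rewrite exprS i2 mulrN1.
have ci : conjc 'i%C = - 'i%C :> C by apply/eqP; rewrite eq_complex /= oppr0 !eqxx.
have c1 : conjc (-1) = -1 :> C by rewrite rmorphN rmorph1.
have ci' : conjc (- 'i%C) = 'i%C :> C by apply/eqP; rewrite eq_complex /= oppr0 opprK !eqxx.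
rewrite expr0 expr1 i2 i3 !(innerDl, innerDr, innerZl, innerZr) (rmorph1 (@conjc R)) ci' ci c1.
rewrite -[LHS](mulKf (_ : 4 != 0)) ?pnatr_eq0// -!mulrA -!mulrDr; congr (_ * _).
have ii : 'i%C * 'i%C = -1 :> C by rewrite -expr2.
move: ('i%C : C) ii => j jj.
move: (inner u A u) (inner u A v) (inner v A u) (inner v A v) => a b c e.
ring: jj.
Qed.

(** An index consists of a matrix position and an exponent of the imaginary unit. *)
Definition pol_vec (k : 'I_d * 'I_d * 'I_4) : 'cV[C]_d :=
  delta_mx k.1.1 ord0 + 'i%C ^+ k.2 *: delta_mx k.1.2 ord0.

Definition pol_mx (k : 'I_d * 'I_d * 'I_4) : 'M[C]_d :=
  (4^-1 * conjc ('i%C ^+ k.2)) *: delta_mx k.1.1 k.1.2.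

(** The coefficients are diagonal values of the form, hence nonnegative reals for positive [A]. This
    is what lets an observable be described by positive measures alone. *)
Lemma matrix_polarization A :
  A = \sum_k inner (pol_vec k) A (pol_vec k) *: pol_mx k.
Proof.
rewrite -(pair_bigA _ (fun p (k : 'I_4) =>
  inner (pol_vec (p, k)) A (pol_vec (p, k)) *: pol_mx (p, k)))/=.
rewrite {1}[A]matrix_sum_delta pair_bigA /=.
apply: eq_bigr => -[i j] _ /=.
rewrite -[A i j]inner_delta inner_polarization scaler_suml; apply: eq_bigr => k _.
by rewrite scalerA mulrC.
Qed.

Definition clone_mx A B : 'M[C]_d :=
  (real_complex R (2 * (1 + d%:R))^-1) *: (\tr B *: A + \tr A *: B + A *m B + B *m A).

Lemma clone_mxC A B : clone_mx A B = clone_mx B A.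
Proof. by rewrite /clone_mx [\tr B *: A + _]addrC addrAC. Qed.

Lemma clone_mx_suml (I : finType) (a : I -> C) (F : I -> 'M[C]_d) B :
  clone_mx (\sum_i a i *: F i) B = \sum_i a i *: clone_mx (F i) B.
Proof.
rewrite /clone_mx; under [RHS]eq_bigr do rewrite scalerA mulrC -scalerA.
rewrite -scaler_sumr; congr (_ *: _); rewrite scaler_sumr raddf_sum scaler_suml.
rewrite mulmx_suml mulmx_sumr -!big_split /=; apply: eq_bigr => i _.
by rewrite mxtraceZ -!scalemxAl -!scalemxAr !scalerDr !scalerA mulrC.
Qed.

Lemma clone_mx_sumr (I : finType) (a : I -> C) (F : I -> 'M[C]_d) A :
  clone_mx A (\sum_i a i *: F i) = \sum_i a i *: clone_mx A (F i).
Proof. by rewrite clone_mxC clone_mx_suml; under eq_bigr do rewrite clone_mxC. Qed.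

Lemma psd_clone_mx A B : psd A -> psd B -> psd (clone_mx A B).
Proof.
move=> pA pB v; rewrite inner_scale mulr_ge0 ?psd_clone//.
by rewrite ler0c invr_ge0 mulr_ge0// addr_ge0.
Qed.

(** The numerator [2 + d] counts [d] copies of [A] from [tr 1 = d] and one from each of the two
    products with the identity. *)
Lemma clone_mx1 A : clone_mx A 1%:M =
  real_complex R ((2 + d%:R) / (2 * (1 + d%:R))) *: A +
  (real_complex R (2 * (1 + d%:R))^-1 * \tr A) *: 1%:M.
Proof.
rewrite /clone_mx mxtrace1 mulmx1 mul1mx.
rewrite (rmorphM (real_complex R) (2 + d%:R)) (rmorphD (real_complex R)) !rmorph_nat.
by apply/matrixP => i j; rewrite !mxE; ring.
Qed.

Lemma clone_mx11 : clone_mx 1%:M 1%:M = 1%:M :> 'M[C]_d.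
Proof.
have dn0 : 2 * (1 + d%:R) != 0 :> R by rewrite mulf_neq0// gt_eqF// ltr_pwDl.
have k1 : real_complex R (2 * (1 + d%:R))^-1 * (2 * (1 + d%:R)) = 1.
  rewrite [X in _ * X](_ : _ = real_complex R (2 * (1 + d%:R))).
    by rewrite -rmorphM mulVf.
  by rewrite (rmorphM (real_complex R)) (rmorphD (real_complex R) 1 d%:R) rmorph1 !rmorph_nat.
rewrite /clone_mx mulmx1 mxtrace1; apply/matrixP => i j; rewrite !mxE.
transitivity (real_complex R (2 * (1 + d%:R))^-1 * (2 * (1 + d%:R)) * (i == j)%:R).
  by ring.
by rewrite k1 mul1r.
Qed.

End polarization.

(** * Measures from real-valued set functions *)

Section real_set_functions.
Context {R : realType} {dT : measure_display} {T : measurableType dT}.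

Lemma finite_measure_of_real_set_function (Om : set T) (f : set T -> R) :
  measurable Om ->
  (forall X, measurable X -> X `<=` Om -> 0 <= f X) ->
  (forall F : nat -> set T, (forall k, measurable (F k) /\ F k `<=` Om) ->
     trivIset setT F ->
     (fun n => \sum_(k < n) f (F k)) @ \oo --> f (\bigcup_k F k)) ->
  exists m : {finite_measure set T -> \bar R},
    forall X, measurable X -> m X = (f (X `&` Om))%:E.
Proof.
move=> mOm f0 fs.
(* [Num.max 0] makes the function nonnegative on nonmeasurable sets too *)
pose g (X : set T) : \bar R := (Num.max 0 (f (X `&` Om)))%:E.
have gE X : measurable X -> g X = (f (X `&` Om))%:E.
  move=> mX; rewrite /g max_r// f0//; first exact: measurableI.
(* Additivity on the constant empty sequence makes the series with constant term [f set0] converge,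
   so that term is zero. *)
have fset0 : f set0 = 0.
  have := fs (fun=> set0) (fun=> conj measurable0 (@sub0set _ _)) (@trivIset_set0 _ _ _).
  rewrite bigcup0// => h.
  have : series (fun=> f set0) @ \oo --> f set0.
    by apply: cvg_trans h; apply: near_eq_cvg; near=> n; rewrite /series /= big_mkord.
  move=> /cvgP/cvg_series_cvg_0 /cvg_lim <- //; rewrite lim_cst//.
have g0 : g set0 = 0 by rewrite gE// set0I fset0.
have gge X : (0 <= g X)%E by rewrite lee_fin le_max lexx.
have gs : semi_sigma_additive g.
  move=> F mF tF mUF; rewrite gE// setI_bigcupl.
  have {}fs := fs (fun k => F k `&` Om) _ (@trivIset_setIr _ _ _ _ _ tF).
  rewrite [X in X @ _ --> _](_ : _ = EFin \o (fun n => \sum_(k < n) f (F k `&` Om))); last first.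
    apply/funext => n /=; rewrite big_mkord -sumEFin; apply: eq_bigr => i _.
    exact: gE.
  apply: cvg_EFin; first by near=> n.
  by apply: fs => k; split; [exact: measurableI|move=> x []].
have gfin : fin_num_fun g by move=> X mX.
pose m1 := isMeasure.Build _ _ _ g g0 gge gs.
pose m2 := Measure_isFinite.Build _ _ _ (HB.pack_for {measure set T -> \bar R} g m1) gfin.
exists (HB.pack_for {finite_measure set T -> \bar R} g m1 m2).
exact: gE.
Unshelve. all: by end_near.
Qed.

Lemma probability_of_measure (m : {measure set T -> \bar R}) :
  m setT = 1%E -> exists P : probability T R, forall X, P X = m X.
Proof.
move=> m1.
pose g X := m X; have g1 : g setT = 1%E by [].
pose h1 := isMeasure.Build _ _ _ g (measure0 m) (measure_ge0 m)
  (@measure_semi_sigma_additive _ _ _ m).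
pose h2 := Measure_isProbability.Build _ _ _
  (HB.pack_for {measure set T -> \bar R} g h1) g1.
by exists (HB.pack_for (probability T R) g h1 h2).
Qed.

End real_set_functions.

(** * Real and complex forms of weak sigma-additivity *)

Section complex_limits.
Context {R : realType}.
Local Notation C := (R[i] : numClosedFieldType).

(* A positive element of [R[i]] is a positive real, so both topologies have the
   same balls on the real line. *)
Lemma cvg_real_complex (f : nat -> R) (l : R) :
  (real_complex R (f n) : C) @[n --> \oo] --> (real_complex R l : C) <->
  f n @[n --> \oo] --> l.
Proof.
have normB (a b : R) : `|real_complex R a - real_complex R b| = `|a - b|%:C%C.
  by rewrite -rmorphB normc_def /= expr0n addr0 sqrtr_sqr.
split=> /cvgrPdist_lt h; apply/cvgrPdist_lt => e e0.
  have e0' : 0 < e%:C%C :> C by rewrite ltcR.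
  by apply: filterS (h _ e0') => n; rewrite normB ltcR.
case: e e0 => e e'; rewrite ltcE /= => /andP[/eqP -> e0].
by apply: filterS (h _ e0) => n; rewrite normB ltcR.
Qed.

(** In [weak_sigma_additive] the real and imaginary parts are elements of [R[i]] and converge there;
    here they are elements of [R], as measures require. *)
Lemma weak_sigma_additiveP {d : nat} {dT : measure_display} {T : measurableType dT}
    (Om : set T) (M : set T -> 'M[R[i]]_d) :
  weak_sigma_additive Om M <->
  forall F : nat -> set T,
    (forall k, measurable (F k) /\ F k `<=` Om) -> trivIset setT F ->
    forall u v : 'cV[R[i]]_d,
      ((fun n => \sum_(k < n) Re (inner u (M (F k)) v)) @ \oo -->
          Re (inner u (M (\bigcup_k F k)) v)) /\
      ((fun n => \sum_(k < n) Im (inner u (M (F k)) v)) @ \oo -->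
          Im (inner u (M (\bigcup_k F k)) v)).
Proof.
have sumRe (F : nat -> set T) u v n : \sum_(k < n) 'Re (inner u (M (F k)) v) =
    (\sum_(k < n) Re (inner u (M (F k)) v))%:C%C.
  by rewrite rmorph_sum; apply: eq_bigr => k _; rewrite -complexRe.
have sumIm (F : nat -> set T) u v n : \sum_(k < n) 'Im (inner u (M (F k)) v) =
    (\sum_(k < n) Im (inner u (M (F k)) v))%:C%C.
  by rewrite rmorph_sum; apply: eq_bigr => k _; rewrite -complexIm.
split=> h F mF tF u v; have [h1 h2] := h F mF tF u v.
  split; apply/cvg_real_complex.
    by move: h1; under eq_fun do rewrite sumRe; rewrite -complexRe.
  by move: h2; under eq_fun do rewrite sumIm; rewrite -complexIm.
split.
  under eq_fun do rewrite sumRe.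
  by rewrite -complexRe; apply/cvg_real_complex.
under eq_fun do rewrite sumIm.
by rewrite -complexIm; apply/cvg_real_complex.
Qed.
End complex_limits.

(** * The algebra of finite unions of rectangles *)

Section rectangles.
Context {R : realType} {d1 d2 : measure_display}.
Context {T1 : measurableType d1} {T2 : measurableType d2}.

(* Finite unions of measurable rectangles, presented through finite measurable
   partitions of the two factors: Boolean combinations are then immediate. *)
Definition rectangular (A : set (T1 * T2)) : Prop :=
  exists (I J : finType) (f : T1 -> I) (g : T2 -> J) (S : {pred I * J}),
    [/\ forall i, measurable (f @^-1` [set i]),
        forall j, measurable (g @^-1` [set j]) &
        A = [set z | S (f z.1, g z.2)]].

Lemma rectangular_setX X Y : measurable X -> measurable Y ->
  rectangular (X `*` Y).
Proof.
(* Each factor is split into a set and its complement. *)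
move=> mX mY; exists bool, bool, (fun x => x \in X), (fun y => y \in Y).
exists (fun p => p.1 && p.2).
have mem (d : measure_display) (T : measurableType d) (Z : set T) b :
    measurable Z -> measurable ((fun x => x \in Z) @^-1` [set b]).
  move=> mZ; case: b.
    rewrite (_ : _ @^-1` _ = Z)//; apply/seteqP; split => x /=; last by move/mem_set.
    by move/set_mem.
  rewrite (_ : _ @^-1` _ = ~` Z); first exact: measurableC.
  apply/seteqP; split => x /=; last by move=> nZ; rewrite memNset.
  by move=> /negbT; rewrite notin_setE.
split; [by move=> i; exact: mem|by move=> i; exact: mem|].
apply/seteqP; split => -[x y] /=; first by case=> ? ?; apply/andP; split; exact/mem_set.
by case/andP => /set_mem ? /set_mem.
Qed.

Lemma rectangularC A : rectangular A -> rectangular (~` A).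
Proof.
case=> I [J [f [g [S [mf mg ->]]]]]; exists I, J, f, g, (fun p => ~~ S p).
by split => //; apply/seteqP; split => -[x y] /= /negP.
Qed.

Lemma rectangularU A B : rectangular A -> rectangular B ->
  rectangular (A `|` B).
Proof.
have pairE (d : measure_display) (T : measurableType d) (I J : finType)
    (f : T -> I) (g : T -> J) : (forall i, measurable (f @^-1` [set i])) ->
    (forall j, measurable (g @^-1` [set j])) ->
    forall p, measurable ((fun x => (f x, g x)) @^-1` [set p]).
  move=> mf mg [i j].
  rewrite (_ : _ @^-1` _ = f @^-1` [set i] `&` g @^-1` [set j]); first exact: measurableI.
  by apply/seteqP; split => x /=; [case|case=> -> ->].
case=> I [J [f [g [S [mf mg ->]]]]] [I' [J' [f' [g' [S' [mf' mg' ->]]]]]].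
(* Pairs of labels describe the common refinement of the partitions. *)
exists (I * I')%type, (J * J')%type, (fun x => (f x, f' x)), (fun y => (g y, g' y)).
exists (fun p => S (p.1.1, p.2.1) || S' (p.1.2, p.2.2)).
split; [exact: pairE|exact: pairE|].
by apply/seteqP; split => -[x y] /= => [/orP|]; [|move=> ?; apply/orP].
Qed.

(** The rectangles are cells of the product partition, hence disjoint, so measures add over them. *)
Lemma rectangular_bigcup A : rectangular A ->
  exists (K : finType) (S : {pred K}) (X : K -> set T1) (Y : K -> set T2),
    [/\ forall k, measurable (X k), forall k, measurable (Y k),
        trivIset [set` S] (fun k => X k `*` Y k) &
        A = \bigcup_(k in [set` S]) (X k `*` Y k)].
Proof.
case=> I [J [f [g [S [mf mg ->]]]]]; exists (I * J)%type, S.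
exists (fun p => f @^-1` [set p.1]), (fun p => g @^-1` [set p.2]); split => //.
- by move=> [i j] [i' j'] _ _ [[x y]] /= [[-> ->] [-> ->]].
- apply/seteqP; split => -[x y] /=; first by move=> h; exists (f x, g y).
  by case=> -[i j] /= ? [-> ->].
Qed.

Lemma rectangular_measurable A : rectangular A -> measurable A.
Proof.
move=> /rectangular_bigcup[K [S [X [Y [mX mY _ ->]]]]].
apply: fin_bigcup_measurable => [|k _]; first exact: finite_finset.
exact: measurableX.
Qed.

End rectangles.

(** * Approximation by rectangles for finite measures *)

Lemma cvg_sum_fine_measure {R : realType} {d : measure_display}
    {T : measurableType d} (m : {finite_measure set T -> \bar R}) (F : nat -> set T) :
  (forall k, measurable (F k)) -> trivIset setT F ->
  (fun n => \sum_(k < n) fine (m (F k))) @ \oo --> fine (m (\bigcup_k F k)).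
Proof.
move=> mF tF; have mUF := bigcupT_measurable _ mF.
have := @measure_semi_sigma_additive _ _ _ m F mF tF mUF.
rewrite -[X in _ --> X]fineK ?fin_num_measure// => /fine_cvg.
apply: cvg_trans; apply: near_eq_cvg; near=> n => /=.
by rewrite big_mkord sum_fine// => i _; rewrite fin_num_measure.
Unshelve. all: by end_near.
Qed.

Section approximation.
Context {R : realType} {d1 d2 : measure_display}.
Context {T1 : measurableType d1} {T2 : measurableType d2}.
Local Notation T := (T1 * T2)%type.

Section one_measure.
Context (m : {finite_measure set T -> \bar R}).

Let le_m A B : measurable A -> measurable B -> A `<=` B -> (m A <= m B)%E.
Proof. by move=> mA mB; apply: le_measure; rewrite inE. Qed.

Lemma measurable_setY (A B : set T) : measurable A -> measurable B ->
  measurable (A `+` B).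
Proof. by move=> mA mB; apply: measurableU; exact: measurableD. Qed.

(** This is the closure of the rectangular sets for the pseudometric given by the measure of the
    symmetric difference. *)
Definition approximable (Z : set T) : Prop :=
  forall e : R, 0 < e -> exists A, rectangular A /\ (m (Z `+` A) < e%:E)%E.

Lemma approximableC Z : approximable Z -> approximable (~` Z).
Proof.
move=> aZ e e0; have [A [rA h]] := aZ e e0.
exists (~` A); split; first exact: rectangularC.
by rewrite /setY !setDE !setCK [~` Z `&` _]setIC [~` A `&` _]setIC setUC in h *.
Qed.

Lemma approximableU Z Z' : measurable Z -> measurable Z' ->
  approximable Z -> approximable Z' -> approximable (Z `|` Z').
Proof.
move=> mZ mZ' aZ aZ' e e0.
have [A [rA h]] := aZ _ (divr_gt0 e0 (ltr0n R 2)).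
have [A' [rA' h']] := aZ' _ (divr_gt0 e0 (ltr0n R 2)).
exists (A `|` A'); split; first exact: rectangularU.
have mA := rectangular_measurable _ rA; have mA' := rectangular_measurable _ rA'.
apply: (@le_lt_trans _ _ (m ((Z `+` A) `|` (Z' `+` A')))).
  apply: le_m.
  - by apply: measurable_setY; exact: measurableU.
  - by apply: measurableU; exact: measurable_setY.
  - by move=> x; rewrite /setY /setD /=; tauto.
apply: (@le_lt_trans _ _ (m (Z `+` A) + m (Z' `+` A'))%E).
  by apply: measureU2; exact: measurable_setY.
by rewrite [e]splitr EFinD lteD.
Qed.

(** By continuity from below, a finite partial union misses at most [e / 2] of the measure; the
    other half is spent on approximating that finite union. *)
Lemma approximable_bigcup (F : nat -> set T) :
  (forall n, measurable (F n)) -> (forall n, approximable (F n)) ->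
  approximable (\bigcup_n F n).
Proof.
move=> mF aF e e0.
pose U n := \big[setU/set0]_(i < n) F i.
have mU n : measurable (U n) by apply: bigsetU_measurable => i _.
have aU n : approximable (U n).
  elim: n => [|n ih].
    move=> r r0; exists set0; split; last by rewrite /U big_ord0 setYK measure0.
    by rewrite -(@set0X T1 T2 setT); exact: rectangular_setX.
  by rewrite /U big_ord_recr /=; exact: approximableU _ _ (mU n) (mF n) ih (aF n).
have mUF : measurable (\bigcup_n F n) by exact: bigcup_measurable.
have e2 : 0 < e / 2 by rewrite divr_gt0.
have [n hn] : exists n, (m ((\bigcup_n F n) `\` U n) < (e / 2)%:E)%E.
  have cU : m \o U @ \oo --> m (\bigcup_n F n).
    have UE : \bigcup_n U n = \bigcup_n F n.
      apply/seteqP; split => [x [k _ Ux]|x [k _ Fx]]; first exact: bigsetU_bigcup Ux.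
      by exists k.+1 => //; rewrite /U big_ord_recr; right.
    rewrite -UE; apply: nondecreasing_cvg_mu => //; first by rewrite UE.
    by move=> a b ab; apply/subsetPset; exact: subset_bigsetU.
  have /fine_cvgP[_ /cvgrPdist_lt /(_ _ e2)[N _ hN]] :
      m \o U @ \oo --> (fine (m (\bigcup_n F n)))%:E.
    by rewrite fineK// fin_num_measure.
  exists N; have := hN N (leqnn N) => /=.
  have UF : U N `<=` \bigcup_n F n by exact: bigsetU_bigcup.
  have -> : m ((\bigcup_n F n) `\` U N) =
      (fine (m (\bigcup_n F n)) - fine (m (U N)))%:E.
    rewrite EFinB !fineK ?fin_num_measure// measureD//; last first.
      by rewrite ltey_eq fin_num_measure.
    by rewrite setIC setIidl.
  rewrite lte_fin.
  by move=> h; exact: le_lt_trans (ler_norm _) h.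
have [A [rA h]] := aU n _ e2; exists A; split => //.
have mA := rectangular_measurable _ rA.
apply: (@le_lt_trans _ _ (m (((\bigcup_n F n) `\` U n) `|` (U n `+` A)))).
  apply: le_m.
  - exact: measurable_setY.
  - by apply: measurableU; [exact: measurableD|exact: measurable_setY].
  - have UF : U n `<=` \bigcup_n F n by exact: bigsetU_bigcup.
    by move=> x; have := UF x; rewrite /setY /setD /=; have := pselect (U n x); tauto.
apply: (@le_lt_trans _ _ (m ((\bigcup_n F n) `\` U n) + m (U n `+` A))%E).
  by apply: measureU2; [exact: measurableD|exact: measurable_setY].
by rewrite [e]splitr EFinD lteD.
Qed.

(** Rectangles are stable under intersection and generate the product sigma-algebra, while the
    approximable sets are closed under the operations of a Dynkin system. *)
Lemma measurable_approximable Z : measurable Z -> approximable Z.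
Proof.
rewrite measurable_prod_measurableType.
apply: dynkin_induction; first exact: measurable_prod_measurableType.
- move=> _ _ [X mX [Y mY <-]] [X' mX' [Y' mY' <-]]; rewrite -setXI.
  by exists (X `&` X'); [exact: measurableI|exists (Y `&` Y') => //; exact: measurableI].
- move=> e e0; exists setT; split; last by rewrite setYK measure0.
  by rewrite -setXTT; exact: rectangular_setX.
- move=> _ [X mX [Y mY <-]] e e0; exists (X `*` Y).
  by split; [exact: rectangular_setX|rewrite setYK measure0].
- by move=> S _; exact: approximableC.
- by move=> F mF _; exact: approximable_bigcup.
Qed.

End one_measure.

Lemma fine_measure_setY (m : {finite_measure set T -> \bar R}) Z A :
  measurable Z -> measurable A ->
  `|fine (m Z) - fine (m A)| <= fine (m (Z `+` A)).
Proof.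
have half X Y : measurable X -> measurable Y -> fine (m X) - fine (m Y) <= fine (m (X `+` Y)).
  move=> mX mY; rewrite lerBlDl -lee_fin EFinD !fineK ?fin_num_measure//;
    last exact: measurable_setY.
  apply: (@le_trans _ _ (m (Y `|` (X `+` Y))));
    last by apply: measureU2 => //; exact: measurable_setY.
  apply: le_measure; rewrite ?inE//; first by apply: measurableU => //; exact: measurable_setY.
  by move=> x; rewrite /setY /setD /=; have := pselect (Y x); tauto.
move=> mZ mA; rewrite ler_norml half// andbT.
by rewrite lerNl opprB setYC half.
Qed.

(** The coefficients may have any sign. Approximating [Z] for the sum [m] of all the measures gives
    one rectangular set that is close to [Z] for every [P i] at once, so a negative value at [Z]
    would persist there. *)
Lemma sum_measures_ge0_of_rectangles (I : finType) (c : I -> R)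
    (P : I -> {finite_measure set T -> \bar R}) :
  (forall X Y, measurable X -> measurable Y ->
     0 <= \sum_i c i * fine (P i (X `*` Y))) ->
  forall Z, measurable Z -> 0 <= \sum_i c i * fine (P i Z).
Proof.
move=> h Z mZ.
have [m mE] : exists m : {finite_measure set T -> \bar R},
    forall X, measurable X -> m X = (\sum_i fine (P i X))%:E.
  have [||m mE] := @finite_measure_of_real_set_function R _ T setT
    (fun X => \sum_i fine (P i X)) measurableT.
  - by move=> X _ _; apply: sumr_ge0 => i _; exact: fine_ge0.
  - move=> F mF tF; rewrite (_ : (fun n => _) =
      (fun n => \sum_i \sum_(k < n) fine (P i (F k)))); last first.
      by apply/funext => n; rewrite exchange_big.
    by apply: (cvg_big add_continuous) => i _; apply: cvg_sum_fine_measure => // k; case: (mF k).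
  - by exists m => X mX; rewrite mE// setIT.
have rect A : rectangular A -> 0 <= \sum_i c i * fine (P i A).
  move=> /rectangular_bigcup[K [S [X [Y [mX mY tXY ->]]]]].
  rewrite (eq_bigr (fun i => \sum_(k | S k) c i * fine (P i (X k `*` Y k)))); last first.
    move=> i _; rewrite measure_fin_bigcup//; last by move=> k _; exact: measurableX.
    rewrite -(@bigfs _ _ _ _ (index_enum K)) ?index_enum_uniq//;
      last by move=> k; rewrite mem_index_enum.
    rewrite -sum_fine ?mulr_sumr// => k _; apply: fin_num_measure; exact: measurableX.
  by rewrite exchange_big; apply: sumr_ge0 => k _; exact: h.
rewrite leNgt; apply/negP => neg.
(* Replacing [Z] by [A] changes the combination by at most [C] times the [m]-measure of their
   symmetric difference; the added 1 keeps [C] positive. *)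
pose C := 1 + \sum_i `|c i|.
have C0 : 0 < C by rewrite ltr_pwDl// sumr_ge0.
(* The tolerance keeps the change below the deficit at [Z], so the value at [A] stays negative. *)
have [|A [rA hA]] := @measurable_approximable m Z mZ (- (\sum_i c i * fine (P i Z)) / C).
  by rewrite divr_gt0// oppr_gt0.
have mA := rectangular_measurable _ rA.
rewrite mE ?lte_fin ?ltr_pdivlMr// in hA; last exact: measurable_setY.
have mYA := measurable_setY _ _ mZ mA.
have := rect A rA; apply/negP; rewrite -ltNge.
have : \sum_i c i * fine (P i A) - \sum_i c i * fine (P i Z) <= (\sum_i fine (P i (Z `+` A))) * C.
  rewrite -sumrB (@le_trans _ _ (\sum_i `|c i| * fine (P i (Z `+` A))))//.
    apply: ler_sum => i _; rewrite -mulrBr (le_trans (ler_norm _))// normrM ler_wpM2l//.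
    by rewrite distrC; exact: fine_measure_setY.
  rewrite /C mulrDr mulr1 ler_wpDl ?sumr_ge0// => [i _|]; first exact: fine_ge0.
  rewrite mulrC mulr_suml; apply: ler_sum => i _; rewrite ler_wpM2l//.
  by rewrite (bigD1 i)//= lerDl sumr_ge0// => j _; exact: fine_ge0.
by lra.
Qed.

End approximation.

(** * Observables as matrix combinations of measures *)

Section matrix_measures.
Context {R : realType} {d : nat} {dT : measure_display} {T : measurableType dT}.
Local Notation C := R[i].
Implicit Types (Om : set T) (M : set T -> 'M[C]_d).

Lemma Re_sum_scaled (I : finType) (a : I -> R) (z : I -> C) :
  Re (\sum_i (a i)%:C%C * z i) = \sum_i Re (z i) * a i.
Proof.
rewrite (big_morph (@complex.Re R) (id1 := 0) (op1 := +%R)) => [|[? ?] [? ?]|]//.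
by apply: eq_bigr => i _; case: (z i) => x y /=; rewrite mul0r subr0 mulrC.
Qed.

Lemma Im_sum_scaled (I : finType) (a : I -> R) (z : I -> C) :
  Im (\sum_i (a i)%:C%C * z i) = \sum_i Im (z i) * a i.
Proof.
rewrite (big_morph (@complex.Im R) (id1 := 0) (op1 := +%R)) => [|[? ?] [? ?]|]//.
by apply: eq_bigr => i _; case: (z i) => x y /=; rewrite mul0r addr0 mulrC.
Qed.

Definition matrix_measure {I : finType} (P : I -> {finite_measure set T -> \bar R})
    (W : I -> 'M[C]_d) : set T -> 'M[C]_d :=
  fun Z => \sum_i (fine (P i Z))%:C%C *: W i.

Section matrix_measure.
Context {I : finType} (P : I -> {finite_measure set T -> \bar R}) (W : I -> 'M[C]_d).

Lemma inner_matrix_measure u Z v : inner u (matrix_measure P W Z) v =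
  \sum_i (fine (P i Z))%:C%C * inner u (W i) v.
Proof. by rewrite inner_sum; under eq_bigr do rewrite inner_scale. Qed.

Lemma matrix_measure_weak_sigma_additive Om :
  weak_sigma_additive Om (matrix_measure P W).
Proof.
apply/weak_sigma_additiveP => F mF tF u v.
have key (c : I -> R) : (fun n => \sum_(k < n) \sum_i c i * fine (P i (F k))) @ \oo -->
    \sum_i c i * fine (P i (\bigcup_k F k)).
  rewrite (_ : (fun n => _) = (fun n => \sum_i c i * \sum_(k < n) fine (P i (F k)))).
    apply: (cvg_big add_continuous) => i _; apply: cvgMr.
    by apply: cvg_sum_fine_measure => // k; case: (mF k).
  by apply/funext => n; rewrite exchange_big; apply: eq_bigr => i _; rewrite mulr_sumr.
split.
  rewrite inner_matrix_measure Re_sum_scaled.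
  by under eq_fun do under eq_bigr do rewrite inner_matrix_measure Re_sum_scaled; exact: key.
rewrite inner_matrix_measure Im_sum_scaled.
by under eq_fun do under eq_bigr do rewrite inner_matrix_measure Im_sum_scaled; exact: key.
Qed.

End matrix_measure.

Lemma observable_inner_measure Om M u : observable Om M ->
  exists m : {finite_measure set T -> \bar R},
    forall X, measurable X -> m X = (Re (inner u (M (X `&` Om)) u))%:E.
Proof.
case=> mOm pM /weak_sigma_additiveP sM _.
apply: (@finite_measure_of_real_set_function _ _ _ Om (fun X => Re (inner u (M X) u))) => //.
  by move=> X mX XOm; apply: psd_ge0; exact: pM.
by move=> F mF tF; have [] := sM F mF tF u u.
Qed.

Lemma observable_matrix_measure Om M : observable Om M ->
  exists m : ('I_d * 'I_d * 'I_4) -> {finite_measure set T -> \bar R},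
    forall X, measurable X -> M (X `&` Om) = matrix_measure m pol_mx X.
Proof.
move=> oM.
have [m mE] := choice (fun k => observable_inner_measure _ _ (pol_vec k) oM).
exists m => X mX; rewrite {1}[M _]matrix_polarization /matrix_measure.
apply: eq_bigr => k _; rewrite mE//= -psd_real//.
by case: oM => mOm pM _ _; apply: pM => [|x []//]; exact: measurableI.
Qed.

Lemma psd1 : psd (1%:M : 'M[C]_d).
Proof.
move=> v; rewrite /inner mulmx1 mxE; apply: sumr_ge0 => i _.
by rewrite !mxE mulrC; exact: mulcJ_ge0.
Qed.

(** The normalized trace is a probability measure: diagonal entries of an observable are measures,
    and [tr 1 = d]. It supplies the noise that the cloning map adds. *)
Lemma trace_trivial_observable Om M : (0 < d)%N -> observable Om M ->
  exists Tr : set T -> 'M[C]_d, trivial_observable Om Tr /\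
    forall X, measurable X -> X `<=` Om -> Tr X = (\tr (M X) / d%:R) *: 1%:M.
Proof.
move=> d0 [mOm pM /weak_sigma_additiveP sM M1].
have d0' : (d%:R : R) != 0 by rewrite pnatr_eq0 -lt0n.
have trE (A : 'M[C]_d) : Re (\tr A) = \sum_i Re (inner (delta_mx i ord0) A (delta_mx i ord0)).
  rewrite /mxtrace (big_morph (@complex.Re R) (id1 := 0) (op1 := +%R)) => [|[? ?] [? ?]|]//.
  by apply: eq_bigr => i _; rewrite inner_delta.
have [||m mE] := @finite_measure_of_real_set_function R _ _ Om
    (fun X => Re (\tr (M X)) / d%:R) mOm.
- move=> X mX XOm; rewrite divr_ge0// trE; apply: sumr_ge0 => i _.
  by apply: psd_ge0; exact: pM.
- move=> F mF tF; under eq_fun do rewrite -mulr_suml.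
  apply: cvgMl; rewrite trE (_ : (fun n => _) = (fun n => \sum_i \sum_(k < n)
      Re (inner (delta_mx i ord0) (M (F k)) (delta_mx i ord0)))); last first.
    by apply/funext => n; rewrite exchange_big; apply: eq_bigr => k _; rewrite trE.
  by apply: (cvg_big add_continuous) => i _;
    have [] := sM F mF tF (delta_mx i ord0) (delta_mx i ord0).
have mOm1 : (Re (\tr (M Om)) / d%:R)%:E = 1%E :> \bar R.
  by rewrite M1 mxtrace1 -(rmorph_nat (real_complex R)) /= divff.
have [mu muE] : exists mu : probability T R, forall X, mu X = m X.
  by apply: probability_of_measure; rewrite [LHS]mE// setTI.
(* Writing it as a one-term combination makes its weak sigma-additivity an instance of the general
   lemma. *)
pose Tr := matrix_measure (fun _ : 'I_1 => m) (fun _ => 1%:M : 'M[C]_d).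
have TrE X : Tr X = (fine (mu X))%:C%C *: 1%:M by rewrite /Tr /matrix_measure big_ord1 muE.
exists Tr; split; first split.
- split => //.
  + move=> X mX XOm v; rewrite TrE inner_scale mulr_ge0 ?psd1// ler0c; exact: fine_ge0.
  + exact: matrix_measure_weak_sigma_additive.
  + by rewrite TrE muE mE// setIid mOm1 scale1r.
- by exists mu; split => [|X _ _]; [rewrite muE mE// setIid|exact: TrE].
- move=> X mX XOm; rewrite TrE muE mE// setIidl//=; congr (_ *: _).
  rewrite rmorphM /= fmorphV rmorph_nat; congr (_ / _).
  by have := psd_trace_ge0 _ (pM X mX XOm); rewrite lecE; case: (\tr _) => a b /= /andP[/eqP-> _].
Qed.

End matrix_measures.

(** * The joint observable and the region *)

Section joint.
Context {R : realType} {d : nat} {d1 d2 : measure_display}.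
Context {T1 : measurableType d1} {T2 : measurableType d2}.
Local Notation C := R[i].

Lemma finite_product_measure (m1 : {finite_measure set T1 -> \bar R})
    (m2 : {finite_measure set T2 -> \bar R}) :
  exists P : {finite_measure set (T1 * T2)%type -> \bar R},
    forall X Y, measurable X -> measurable Y -> P (X `*` Y) = (m1 X * m2 Y)%E.
Proof.
pose m : {measure set (T1 * T2)%type -> \bar R} := (m1 \x m2)%E.
have mfin : fin_num_fun m.
  move=> Z mZ; rewrite ge0_fin_numE//; apply: (@le_lt_trans _ _ (m (setT `*` setT))).
    by apply: le_measure; rewrite ?inE// setXTT.
  by rewrite /m /= product_measure1E// ltey_eq fin_numM// fin_num_measure.
pose g Z := m Z.
pose h1 := isMeasure.Build _ _ _ g (measure0 m) (measure_ge0 m)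
  (@measure_semi_sigma_additive _ _ _ m).
pose h2 := Measure_isFinite.Build _ _ _
  (HB.pack_for {measure set (T1 * T2)%type -> \bar R} g h1) mfin.
exists (HB.pack_for {finite_measure set (T1 * T2)%type -> \bar R} g h1 h2).
by move=> X Y mX mY; rewrite /= /g /m /= product_measure1E.
Qed.

Context (Om1 : set T1) (Om2 : set T2).
Context (M1 : set T1 -> 'M[C]_d) (M2 : set T2 -> 'M[C]_d).
Context (oM1 : observable Om1 M1) (oM2 : observable Om2 M2).

(** Bilinearity of [clone_mx] turns the two polarized expansions into a combination of product
    measures, which is defined on the whole product sigma-algebra. Only positivity then has to be
    extended from rectangles. *)
Lemma clone_observable : exists M : set (T1 * T2) -> 'M[C]_d,
  observable (Om1 `*` Om2) M /\
  forall X Y, measurable X -> measurable Y -> X `<=` Om1 -> Y `<=` Om2 ->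
    M (X `*` Y) = clone_mx (M1 X) (M2 Y).
Proof.
have [m1 m1E] := observable_matrix_measure _ _ oM1.
have [m2 m2E] := observable_matrix_measure _ _ oM2.
have [P PE] := choice (fun p => finite_product_measure (m1 p.1) (m2 p.2)).
pose W p : 'M[C]_d := clone_mx (pol_mx p.1) (pol_mx p.2).
case: oM1 => mOm1 pM1 _ M1Om1; case: oM2 => mOm2 pM2 _ M2Om2.
have rect X Y : measurable X -> measurable Y -> matrix_measure P W (X `*` Y) =
    clone_mx (M1 (X `&` Om1)) (M2 (Y `&` Om2)).
  move=> mX mY; rewrite m1E// m2E// /matrix_measure clone_mx_suml.
  under [RHS]eq_bigr do rewrite clone_mx_sumr scaler_sumr.
  rewrite pair_bigA; apply: eq_bigr => -[k l] _ /=.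
  by rewrite PE// fineM ?fin_num_measure//= rmorphM scalerA.
have rect_psd X Y : measurable X -> measurable Y -> psd (matrix_measure P W (X `*` Y)).
  move=> mX mY; rewrite rect//; apply: psd_clone_mx.
    by apply: pM1 => [|x []//]; exact: measurableI.
  by apply: pM2 => [|x []//]; exact: measurableI.
exists (matrix_measure P W); split; last first.
  by move=> X Y mX mY XO YO; rewrite rect// !setIidl.
split.
- exact: measurableX.
- move=> Z mZ _ v; rewrite inner_matrix_measure lecE Re_sum_scaled Im_sum_scaled /=.
  apply/andP; split; last first.
    apply: sum_measures_ge0_of_rectangles => // X Y mX mY.
    by have := psd_ge0 _ v (rect_psd X Y mX mY); rewrite inner_matrix_measure Re_sum_scaled.
  have Im0 X Y : measurable X -> measurable Y ->
      \sum_i Im (inner v (W i) v) * fine (P i (X `*` Y)) = 0.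
    move=> mX mY; rewrite -Im_sum_scaled -inner_matrix_measure.
    by rewrite (psd_real _ v (rect_psd X Y mX mY)).
  (* The imaginary part is shown to vanish through two inequalities, by applying the rectangle
     criterion to the coefficients and to their opposites. *)
  rewrite eq_le; apply/andP; split; last first.
    by apply: sum_measures_ge0_of_rectangles => // X Y mX mY; rewrite Im0.
  rewrite -oppr_ge0 -sumrN; under eq_bigr do rewrite -mulNr.
  apply: sum_measures_ge0_of_rectangles => // X Y mX mY.
  by under eq_bigr do rewrite mulNr; rewrite sumrN Im0// oppr0.
- exact: matrix_measure_weak_sigma_additive.
- by rewrite rect// !setIid M1Om1 M2Om2 clone_mx11.
Qed.

Let lam : R := (2 + d%:R) / (2 * (1 + d%:R)).

Lemma clone_jm_region : (0 < d)%N -> jm_region Om1 Om2 M1 M2 (lam, lam).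
Proof.
move=> d0.
have dp : (0 : R) < 1 + d%:R by rewrite ltr_pwDl.
have d0' : (d%:R : R) != 0 by rewrite pnatr_eq0 -lt0n.
have lam01 : 0 <= lam <= 1.
  rewrite /lam divr_ge0 ?mulr_ge0 ?addr_ge0//=.
  by rewrite ler_pdivrMr ?mulr_gt0// mul1r mulrDr mulr1 lerD2l ler_peMl// ler1n.
(* The weight of the trace term matches because [(1 - lam) / d = 1 / (2 (1 + d))]. *)
have mixE (A : 'M[C]_d) : clone_mx A 1%:M = lam%:C%C *: A +
    (1 - lam)%:C%C *: ((\tr A / d%:R) *: 1%:M).
  rewrite clone_mx1; congr (_ + _); rewrite scalerA; congr (_ *: _).
  rewrite mulrCA mulrC; congr (_ * _).
  rewrite -(rmorph_nat (real_complex R)) -fmorphV -rmorphM; congr (_%:C)%C.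
  by rewrite /lam; field; rewrite d0' /= gt_eqF.
split => //=.
have [Tr1 [tTr1 Tr1E]] := trace_trivial_observable _ _ d0 oM1.
have [Tr2 [tTr2 Tr2E]] := trace_trivial_observable _ _ d0 oM2.
exists Tr1, Tr2; split => //.
have [M [oM ME]] := clone_observable.
case: oM1 => mOm1 _ _ M1Om1; case: oM2 => mOm2 _ _ M2Om2.
exists M; split => //; split => [X mX XO|Y mY YO].
  by rewrite ME// M2Om2 mixE /mix Tr1E.
by rewrite ME// M1Om1 clone_mxC mixE /mix Tr2E.
Qed.

End joint.

(* Outcome spaces: Borel subsets Om1 of R^n1 and Om2 of R^n2, with R^n modelled
   as n.-tuple R (product = Borel sigma-algebra). *)
Theorem theorem1 (R : realType) (d n1 n2 : nat) (hd : (2 <= d)%N)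
  (Om1 : set (n1.-tuple R)) (Om2 : set (n2.-tuple R))
  (M1 : set (n1.-tuple R) -> 'M[R[i]]_d) (M2 : set (n2.-tuple R) -> 'M[R[i]]_d) :
  observable Om1 M1 -> observable Om2 M2 ->
  [/\ 1 / 2 < (2 + d%:R) / (2 * (1 + d%:R)) :> R,
      (2 + d%:R) / (2 * (1 + d%:R)) <= jmd Om1 Om2 M1 M2 &
      ~ maximally_incompatible Om1 Om2 M1 M2].
Proof.
move=> oM1 oM2.
have dp : (0 : R) < 1 + d%:R by rewrite ltr_pwDl.
have half : 1 / 2 < (2 + d%:R) / (2 * (1 + d%:R)) :> R.
  by rewrite ltr_pdivlMr ?mulr_gt0//; lra.
have jm := clone_jm_region _ _ _ _ oM1 oM2 (ltnW hd).
split => //.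
(* The set defining [jmd] is bounded by 1, so each of its members lies below the supremum. *)
- apply: ub_le_sup; first by exists 1 => x [/andP[]].
  by split => //; case: jm.
(* Maximal incompatibility would force twice the weight to be at most 1, against [half]. *)
- move=> mi; move: jm; rewrite mi /= => -[_ _].
  by lra.
Qed.
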